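(* Let $K$ be a (nonempty) metric space and $A\subset K$. Then $A$ belongs to $\mathcal{D}$ if and only if $A$ is of finite index. Suppose this is the case, and let $n=i(A)$. Write $[t]$ for the greatest integer $\le t$. (a) $\|\chi_A\|_{qD}=n$. (b) (i) If $A\cap\partial^nA=\emptyset$, then $\|\chi_A\|_D=n$. (ii) If $A\cap\partial^nA\ne\emptyset$, then $\|\chi_A\|_D=n+1$. (c) If $A\cap\partial^nA=\emptyset$, then letting $k=[\frac{n+1}{2}]$, $A$ is a union of $k$ disjoint DCS's; moreover one of these sets may be chosen open in case $n$ is odd. (d) If $A\cap\partial^nA\ne\emptyset$, then letting $k=[\frac n2+1]$, $A$ is a union of $k$ disjoint DCS's; moreover one of these may be chosen open in case $n$ is even.
   Context: $\mathcal{D}$ is the algebra of subsets of $K$ generated by the closed (equivalently, open) subsets of $K$. A subset of $K$ is a DCS (difference of closed sets) if it has the form $A_1\setminus A_2$ with $A_1,A_2$ closed in $K$. $\chi_A$ is the characteristic function of $A$. For $L\subset K$, $\partial_LA$ denotes the boundary of $A\cap L$ relative to the metric subspace $L$. Put $\partial^0A=K$ and $\partial^{n+1}A=\partial_LA$ where $L=\partial^nA$. The index $i(A)$ is the largest $n\ge 0$ with $\partial^nA\ne\emptyset$ if there is such an $n$; otherwise $i(A)=\infty$. $A$ is of finite index if $i(A)<\infty$. $D(K)$ is the set of all $f:K\to\mathbb{C}$ of the form $f=(\varphi_1-\varphi_2)+i(\varphi_3-\varphi_4)$ with $\varphi_1,\dots,\varphi_4$ bounded real-valued lower semi-continuous functions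 on $K$. Equivalently, $f\in D(K)$ iff there is a sequence $(\varphi_j)$ of continuous complex-valued functions on $K$ with $\sup_{k\in K}\sum_j|\varphi_j(k)|<\infty$ and $f=\sum_j\varphi_j$ pointwise; $\|f\|_D$ is the infimum of $\sup_{k\in K}\sum_j|\varphi_j(k)|$ over all such sequences. $C_b(K)$ is the space of bounded continuous complex-valued functions on $K$, and for $f\in D(K)$, $\|f\|_{qD}=\inf_{\varphi\in C_b(K)}\|f-\varphi\|_D$. *)

(* Defs.v *)
From HB Require Import structures.
From mathcomp Require Import all_boot all_order all_algebra.
From mathcomp Require Import all_classical all_reals all_analysis.
From mathcomp Require Import complex.

Set Implicit Arguments.
Unset Strict Implicit.
Unset Printing Implicit Defensive.

Import Order.TTheory GRing.Theory Num.Theory.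
Import numFieldNormedType.Exports.

Local Open Scope classical_set_scope.
Local Open Scope ring_scope.
Local Open Scope complex_scope.

Section SetsOfFiniteIndex.
Context {T : topologicalType}.
Implicit Types A B L : set T.

Definition set_algebra (G : set (set T)) : Prop :=
  [/\ G set0, setU_closed G & setC_closed G].

Definition closed_algebra : set (set T) := smallest set_algebra closed.

Definition DCS B : Prop :=
  exists A1 A2, [/\ closed A1, closed A2 & B = A1 `\` A2].

Definition disjoint_DCS_union A k (B : 'I_k -> set T) : Prop :=
  [/\ forall i, DCS (B i), trivIset [set: 'I_k] B & A = \bigcup_i B i].

Definition boundary {X : topologicalType} (A : set X) : set X :=
  closure A `\` interior A.

(* The library gives [subspace L] the whole of [T] as carrier and makes the
   points outside [L] isolated, so they never belong to this boundary; see
   [rel_boundaryE]. *)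
Definition rel_boundary L A : set T := @boundary (subspace L) (A `&` L).

Lemma rel_boundaryE L A :
  rel_boundary L A = L `&` closure (A `&` L) `&` closure (L `\` A).
Proof.
apply/seteqP; split=> x; rewrite /rel_boundary /boundary /closure /interior /=.
  have [Lx|nLx] := pselect (L x); last first.
    move=> [clx _]; have [|y [[_ Ly] xy]] := clx [set x].
      by rewrite /nbhs/= -nbhs_subspace_out.
    by exfalso; apply: nLx; rewrite -xy.
  rewrite /nbhs/= -nbhs_subspace_in// => -[clx nintx].
  split; first split=> //.
    move=> B Bx; apply: clx.
    exact: (@cvg_within _ (nbhs (x : T)) _ L).
  move=> B Bx; apply: contrapT => LAB0; apply: nintx.
  apply: filterS Bx => y By Ly; split=> //; apply: contrapT => nAy.
  by apply: LAB0; exists y.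
move=> [[Lx clx] cl'x]; rewrite /nbhs/= -nbhs_subspace_in//; split.
  move=> B /clx[y [[Ay Ly] LBy]].
  by exists y; split=> //; exact: LBy.
by move=> /cl'x[y [[Ly nAy] /(_ Ly)[]]].
Qed.

Definition boundary_iter A n : set T := iter n (rel_boundary ^~ A) [set: T].

Definition max_boundary_iter A n : Prop :=
  boundary_iter A n !=set0 /\
  forall m, boundary_iter A m !=set0 -> (m <= n)%N.

(* [None] stands for infinity. *)
Definition boundary_index A : option nat :=
  xget None [set Some n | n in max_boundary_iter A].

Definition finite_index A : Prop := exists n, boundary_index A = Some n.

Lemma boundary_indexP A n :
  boundary_index A = Some n <-> max_boundary_iter A n.
Proof.
rewrite /boundary_index; split=> [|nA].
  by case: xgetP => // _ -> [m mA <-] [<-].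
case: xgetP => [_ -> [m mA <-]|/(_ (Some n)) []]; last by exists n.
congr Some; apply/eqP; rewrite eqn_leq.
by rewrite (nA.2 _ mA.1) (mA.2 _ nA.1).
Qed.

End SetsOfFiniteIndex.

Section DifferencesOfSemicontinuousFunctions.
Context {R : realType} {K : topologicalType}.
Implicit Types (f : K -> R[i]^o) (phi : nat -> K -> R[i]^o).

Definition bounded_lsc (g : K -> R) : Prop :=
  bounded_fun g /\ lower_semicontinuous (EFin \o g).

Definition D_space f : Prop :=
  exists g1 g2 g3 g4 : K -> R,
    [/\ bounded_lsc g1, bounded_lsc g2, bounded_lsc g3, bounded_lsc g4 &
        forall k, f k = (g1 k - g2 k) +i* (g3 k - g4 k)].

Definition sup_abs_sum phi : \bar R :=
  ereal_sup [set (\sum_(0 <= j <oo) (Normc.normc (phi j k))%:E)%E | k in [set: K]].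

Definition D_series f phi : Prop :=
  [/\ forall j, continuous (phi j), (sup_abs_sum phi < +oo)%E &
      forall k, series (phi ^~ k) @ \oo --> f k].

(* Both norms take their values in the extended reals, the infimum of the
   empty set being +oo; they are finite on [D_space]. *)
Definition D_norm f : \bar R := 
  ereal_inf [set sup_abs_sum phi | phi in D_series f].

Definition Cb f : Prop := continuous f /\ bounded_fun f.

Definition qD_norm f : \bar R := ereal_inf [set D_norm (f \- g) | g in Cb].

End DifferencesOfSemicontinuousFunctions.

(* Main.v *)
Require Import Defs.
From HB Require Import structures.
From mathcomp Require Import all_boot all_order all_algebra.
From mathcomp Require Import all_classical all_reals all_analysis.
From mathcomp Require Import complex.
From mathcomp Require Import zify ring lra.

(* Let [r x] be the largest [k] such that [x] lies in the [k]-th iterated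
   boundary.  Near [x], [r] is at most [r x], and membership in [A] is constant
   where equality holds; conversely a bounded [r] with this local property
   forces the iterated boundaries to become empty.  This criterion is stable
   under complement (same [r]) and union (sum of the two functions), and holds
   for closed sets.

   Lower bounds: if [chi_A - g] is the sum of a series of continuous functions
   [phi_j] with [sum_j |phi_j| <= c], then [sum_j |phi_j| <= c - m] on the
   [m]-th iterated boundary.

   Upper bounds: [chi_A - g = u - v] with [u = (N - r + chi_A - g) / 2] and
   [v = (N - r - chi_A + g) / 2], which are lower semicontinuous; they are
   nonnegative with [u + v <= N] as soon as [|chi_A - g| <= N - r].  For
   [D_norm] take [g = 0]; for [qD_norm] let [g] be a Urysohn function equal to
   [chi_A] on the last nonempty iterated boundary. *)

Set Implicit Arguments.
Unset Strict Implicit.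
Unset Printing Implicit Defensive.

Import Order.TTheory GRing.Theory Num.Theory.
Import numFieldNormedType.Exports.
Import Normc.

Local Open Scope classical_set_scope.
Local Open Scope ring_scope.

(** * Iterated boundaries and integer functions that stratify a set *)

Section BoundaryRank.
Context {T : topologicalType}.
Implicit Types (A B C : set T) (r s : T -> nat).

Lemma boundary_iterS A k :
  boundary_iter A k.+1 = rel_boundary (boundary_iter A k) A.
Proof. by rewrite /boundary_iter iterS. Qed.

Lemma closed_boundary_iter A k : closed (boundary_iter A k).
Proof.
elim: k => [|k IHk]; first exact: closedT.
rewrite boundary_iterS rel_boundaryE.
by apply: closedI; [apply: closedI|] => //; exact: closed_closure.
Qed.

Lemma subset_boundary_iterS A k : boundary_iter A k.+1 `<=` boundary_iter A k.
Proof. by rewrite boundary_iterS rel_boundaryE => x [[]]. Qed.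

Lemma subset_boundary_iter A k m :
  (k <= m)%N -> boundary_iter A m `<=` boundary_iter A k.
Proof.
move=> /subnK <-; elim: (m - k)%N => // d IHd.
by rewrite addSn; apply: subset_trans IHd; exact: subset_boundary_iterS.
Qed.

(** Such an [r] only bounds the boundary rank from above; this slack is what lets the property pass
    to unions, where the functions are added. *)
Definition stratified A r := forall x, \forall y \near x,
  (r y <= r x)%N /\ (r y = r x -> (A y <-> A x)).

(** Induction on [k]: near a point of the next boundary lies a point of the present one on the other
    side of [A], and changing sides costs a strict drop of [r]. *)
Lemma stratified_boundary_iter A r k x :
  stratified A r -> boundary_iter A k x -> (k <= r x)%N.
Proof.
move=> sAr; elim: k x => // k IHk x.
rewrite boundary_iterS rel_boundaryE => -[[_ clAx] clnAx].
suff [y [Ly [ryx yx nyx]]] : exists y, boundary_iter A k y /\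
    [/\ (r y <= r x)%N, r y = r x -> (A y <-> A x) & ~ (A y <-> A x)].
  rewrite (leq_ltn_trans (IHk _ Ly))// ltn_neqAle ryx andbT.
  by apply/eqP => /yx.
have [Ax|nAx] := pselect (A x).
  by have [y [[Ly nAy] [? ?]]] := clnAx _ (sAr x); exists y; split=> //;
    split=> // -[_ /(_ Ax)].
by have [y [[Ay Ly] [? ?]]] := clAx _ (sAr x); exists y; split=> //;
  split=> // -[/(_ Ay)].
Qed.

Definition boundary_rank A r :=
  forall x k, boundary_iter A k x <-> (k <= r x)%N.

Lemma boundary_rank_exists A n :
  boundary_iter A n = set0 -> exists r, boundary_rank A r.
Proof.
move=> An0; suff /choice[r rP] : forall x, exists m,
    forall k, boundary_iter A k x <-> (k <= m)%N by exists r.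
move=> x; pose P k := `[< boundary_iter A k x >].
have P0 : exists k, P k by exists 0%N; apply/asboolP.
have Pn k : P k -> (k <= n)%N.
  move=> /asboolP Akx; rewrite leqNgt;
    apply/negP => /ltnW /(@subset_boundary_iter A).
  by rewrite An0 => /(_ _ Akx).
case: (ex_maxnP P0 Pn) => r /asboolP Arx rmax; exists r => k; split=> [Akx|kr].
  by apply: rmax; apply/asboolP.
exact: subset_boundary_iter Arx.
Qed.

(** The boundary of order [(r x).+1] is closed and misses [x], so [r] does not increase nearby; and
    [x], lying in the boundary of order [r x] but not in the next, has a neighbourhood that meets it
    on one side of [A] only. *)
Lemma boundary_rank_stratified A r : boundary_rank A r -> stratified A r.
Proof.
move=> rP x.
have ry : \forall y \near x, (r y <= r x)%N.
  have : nbhs x (~` boundary_iter A (r x).+1).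
    apply: open_nbhs_nbhs; split; first exact/closed_openC/closed_boundary_iter.
    by move=> /rP; rewrite ltnn.
  by apply: filterS => y ny; rewrite leqNgt; apply/negP => /rP.
pose L := boundary_iter A (r x).
have Lx : L x by apply/rP.
suff : \forall y \near x, L y -> (A y <-> A x).
  apply: filterS2 ry => y ryx AL; split=> // rE; apply: AL.
  by apply/rP; rewrite rE.
have : ~ rel_boundary L A x by rewrite -boundary_iterS => /rP; rewrite ltnn.
rewrite rel_boundaryE.
have [Ax|nAx] := pselect (A x) => nb.
  have : ~ closure (L `\` A) x.
    by move=> ?; apply: nb; split=> //; split=> //; apply: subset_closure.
  rewrite -[~ _]/((~` closure (L `\` A)) x) -interiorC.
  by apply: filterS => y nLA Ly; split=> // _; apply: contrapT => nAy;
    apply: nLA.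
have : ~ closure (A `&` L) x.
  by move=> ?; apply: nb; split=> //; apply: subset_closure.
rewrite -[~ _]/((~` closure (A `&` L)) x) -interiorC.
by apply: filterS => y nLA Ly; split=> // Ay; exfalso; apply: nLA.
Qed.

Lemma stratifiedC A r : stratified A r -> stratified (~` A) r.
Proof.
move=> sAr x; apply: filterS (sAr x) => y [ryx AE]; split=> // /AE[yx xy].
by split=> nA ?; apply: nA; auto.
Qed.

(** Two values that cannot increase and whose sum is unchanged are both unchanged. *)
Lemma stratifiedU A B r s : stratified A r -> stratified B s ->
  stratified (A `|` B) (fun x => (r x + s x)%N).
Proof.
move=> sAr sBs x; apply: filterS2 (sAr x) (sBs x) => y [ryx AE] [syx BE].
split; first exact: leq_add.
move=> rsE; have [/AE[AE1 AE2] /BE[BE1 BE2]] : r y = r x /\ s y = s x by lia.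
by split=> -[]; [left|right|left|right]; auto.
Qed.

Lemma stratified_closed C : closed C -> stratified C (fun x => `[< C x >] :
  nat).
Proof.
move=> cC x; have [Cx|nCx] := pselect (C x).
  apply: nearW => y; rewrite (asboolT Cx) leq_b1; split=> // /eqP.
  by rewrite eqb1 => /asboolP.
have : nbhs x (~` C) by apply: open_nbhs_nbhs; split=> //; exact: closed_openC.
by apply: filterS => y nCy; rewrite !asboolF.
Qed.

(** In a nonempty space 0 is always a candidate index, and an empty boundary bounds the candidates,
    so a largest one exists. *)
Lemma finite_indexP A : [set: T] !=set0 ->
  finite_index A <-> exists n, boundary_iter A n = set0.
Proof.
move=> T0; split=> [[n /boundary_indexP[_ nmax]]|[n An0]].
  by exists n.+1; apply/eqP/negP => /negP/set0P/nmax; rewrite ltnn.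
pose P k := `[< boundary_iter A k !=set0 >].
have P0 : exists k, P k by exists 0%N; apply/asboolP.
have Pn k : P k -> (k <= n)%N.
  move=> /asboolP[x Akx]; rewrite leqNgt;
    apply/negP => /ltnW /(@subset_boundary_iter A).
  by rewrite An0 => /(_ _ Akx).
case: (ex_maxnP P0 Pn) => m /asboolP Am mmax; exists m.
by apply/boundary_indexP; split=> // k Ak; apply: mmax; apply/asboolP.
Qed.

(** The sets with a bounded stratifying function form an algebra containing the closed sets. *)
Lemma closed_algebra_stratified A : closed_algebra A ->
  exists r m, stratified A r /\ forall x, (r x <= m)%N.
Proof.
move=> /(_ [set B | exists r m, stratified B r /\ forall x, (r x <= m)%N]);
  apply.
split; last first.
  move=> C /stratified_closed sC.
  by eexists; exists 1%N; split; [exact: sC|move=> x; exact: leq_b1].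
split.
- have /stratified_closed s0 := @closed0 T.
  by eexists; exists 1%N; split; [exact: s0|move=> x; exact: leq_b1].
- move=> B C [r [m [sBr rm]]] [s [p [sCs sp]]].
  exists (fun x => (r x + s x)%N), (m + p)%N; split; first exact: stratifiedU.
  by move=> x; exact: leq_add.
- by move=> B [r [m [sBr rm]]]; exists r, m; split=> //; exact: stratifiedC.
Qed.

(** * Decomposition into differences of closed sets *)

Lemma closed_DCS C : closed C -> DCS C.
Proof. by move=> cC; exists C, set0; rewrite setD0; split=> //;
  exact: closed0. Qed.

Lemma open_DCS C : open C -> DCS C.
Proof.
move=> oC; exists setT, (~` C); rewrite setTD setCK.
by split=> //; exact: open_closedC.
Qed.

(* Off [L_k+2], a point of [closure (A `&` L_k)] outside [A] lies in
   [L_k+1 `\` A]; so one difference of closed sets covers two layers. *)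
Lemma DCS_double_layer A k :
  DCS (A `&` (boundary_iter A k `\` boundary_iter A k.+2)).
Proof.
set L := boundary_iter A k; set M := boundary_iter A k.+1.
have cL : closed L := @closed_boundary_iter A k.
have ML : M `<=` L := @subset_boundary_iterS A k.
exists (closure (A `&` L)), (closure (M `\` A) `|` boundary_iter A k.+2).
split; first exact: closed_closure.
  by apply: closedU; [exact: closed_closure|exact: closed_boundary_iter].
apply/seteqP; split=> x.
  move=> [Ax [Lx nN]]; split; first exact: subset_closure.
  move=> -[clx|//]; have Mx : M x.
    apply: (@closed_boundary_iter A k.+1).
    by apply: closure_subset clx; exact: subDsetl.
  by apply: nN; rewrite boundary_iterS rel_boundaryE; split=> //; split=> //;
    exact: subset_closure.
move=> [clx /not_orP[nclx nN]].
have Lx : L x by apply: cL; apply: closure_subset clx; exact: subIsetr.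
split=> //; apply: contrapT => nAx.
have Mx : M x.
  rewrite /M boundary_iterS rel_boundaryE; split; first by split.
  exact: subset_closure.
by apply: nclx; exact: subset_closure.
Qed.

(** The first boundary is the usual boundary of [A], so what it leaves of [A] is the interior. *)
Lemma open_first_layer A :
  open (A `&` (boundary_iter A 0 `\` boundary_iter A 1)).
Proof.
rewrite boundary_iterS rel_boundaryE -[boundary_iter A 0]/setT.
rewrite setTI setIT [in closure (_ `\` A)]setTD closure_setC -setDE.
rewrite [X in open X](_ : _ = interior A); first exact: open_interior.
apply/seteqP; split=> x.
  move=> [Ax [_ nb]]; apply: contrapT => nAx; apply: nb; split=> //.
  exact: subset_closure.
by move=> Ax; split; [exact: interior_subset|split=> // -[]].
Qed.

Lemma closed_algebraU A B :
  closed_algebra A -> closed_algebra B -> closed_algebra (A `|` B).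
Proof.
move=> cA cB G [Galg Gcl]; case: (Galg) => _ GU _.
by apply: GU; [exact: cA|exact: cB].
Qed.

Lemma DCS_closed_algebra A : DCS A -> closed_algebra A.
Proof.
move=> [A1 [A2 [cA1 cA2 ->]]] G [[_ GU GC] Gcl].
by rewrite setDE -[_ `&` _]setCK setCI setCK; apply: (GC); apply: GU;
  [apply: GC|]; exact: Gcl.
Qed.

Lemma boundary_iter0_closed_algebra A n :
  boundary_iter A n = set0 -> closed_algebra A.
Proof.
(* The boundary of even order [n.*2] is empty as well, so [n] double layers exhaust [A]. *)
move=> An0; rewrite -(setD0 A) -[set0](_ : boundary_iter A n.*2 = set0);
  last first.
  apply/seteqP; split=> // x; rewrite -An0; apply: subset_boundary_iter.
  by rewrite -addnn leq_addr.
elim: n {An0} => [|n IHn].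
  by rewrite setDT; apply: DCS_closed_algebra; apply: closed_DCS;
    exact: closed0.
rewrite doubleS.
have -> : A `\` boundary_iter A n.*2.+2 = (A `\` boundary_iter A n.*2) `|`
    (A `&` (boundary_iter A n.*2 `\` boundary_iter A n.*2.+2)).
  apply/seteqP; split=> x.
    by move=> [Ax nAx]; have [|] := pselect (boundary_iter A n.*2 x);
      [right|left].
  move=> [[Ax nAx]|[Ax [? ?]]]; split=> // Ax2; apply: nAx.
  by do 2 apply: subset_boundary_iterS.
apply: closed_algebraU => //; apply: DCS_closed_algebra;
  exact: DCS_double_layer.
Qed.

Lemma closed_algebraP A : [set: T] !=set0 ->
  closed_algebra A <-> finite_index A.
Proof.
move=> T0; rewrite finite_indexP//; split=> [|[n]];
  last exact: boundary_iter0_closed_algebra.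
move=> /closed_algebra_stratified[r [m [sAr rm]]]; exists m.+1.
apply/seteqP; split=> // x /(stratified_boundary_iter sAr).
by rewrite ltnNge rm.
Qed.

Lemma disjoint_DCS_union_exists A r m : boundary_rank A r ->
  A `&` boundary_iter A m = set0 ->
  exists B : 'I_((m + 1) %/ 2) -> set T,
    disjoint_DCS_union A B /\ (odd m -> exists i, open (B i)).
Proof.
move=> rP Am0.
(* Layers are taken in pairs. For odd [m] the blocks shift down by one and, the subtraction being
   truncated, block 0 is the first layer alone, which is open; for either parity the last block ends
   at [m]. *)
pose B (i : 'I_((m + 1) %/ 2)) := A `&` (boundary_iter A (i.*2 - odd m) `\`
                                         boundary_iter A (i.*2.+2 - odd m)).
have B0open (i : 'I_((m + 1) %/ 2)) : odd m -> (i = 0 :> nat)%N -> open (B i).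
  by rewrite /B => -> ->; exact: open_first_layer.
exists B; split; last first.
  move=> om; have i0 : (0 < (m + 1) %/ 2)%N by lia.
  by exists (Ordinal i0); exact: B0open.
split.
- move=> i; have [/andP[om /eqP i0]|oi] := boolP (odd m && (i == 0 :> nat)).
    by apply: open_DCS; exact: B0open.
  rewrite /B (_ : i.*2.+2 - odd m = (i.*2 - odd m).+2)%N;
    first exact: DCS_double_layer.
  by move: oi; case: (odd m) => /=; lia.
- move=> i j _ _ [x [[_ [/rP i1 i2]] [_ [/rP j1 j2]]]]; apply: val_inj => /=.
  have {}i2 : ~~ (i.*2.+2 - odd m <= r x)%N by apply/negP => /rP.
  have {}j2 : ~~ (j.*2.+2 - odd m <= r x)%N by apply/negP => /rP.
  by move: i1 i2 j1 j2; case: (odd m) => /=; lia.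
- apply/seteqP; split=> [x Ax|x [i _ []]//].
  have rm : (r x < m)%N.
    rewrite ltnNge; apply/negP => /rP mx.
    by have : set0 x by rewrite -Am0.
  (* This is the index of the block that holds the layer of rank [r x]. *)
  have iP : ((r x + odd m) %/ 2 < (m + 1) %/ 2)%N.
    by have := odd_double_half m; move: rm; case: (odd m) => /=; lia.
  exists (Ordinal iP) => //; split=> //; split.
    by apply/rP => /=; case: (odd m) => /=; lia.
  by move=> /rP /=; case: (odd m) => /=; lia.
Qed.

End BoundaryRank.

(** * The real-valued complex modulus *)

Section ComplexModulus.
Context {R : realType}.
Implicit Types (x y : R[i]).
Local Open Scope complex_scope.

Lemma normr_normc x : `|x| = (normc x)%:C.
Proof. by rewrite normc_def; case: x. Qed.

Lemma normc_triangle x y : normc (x + y) <= normc x + normc y.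
Proof. exact: (@le_normcD R x y). Qed.

Lemma normcB x y : normc (x - y) = normc (y - x).
Proof. by rewrite -opprB; exact: (@normcN R (y - x)). Qed.

Lemma normc_real (a : R) : normc a%:C = `|a|.
Proof. by rewrite /= expr0n/= addr0 sqrtr_sqr. Qed.

Lemma normc_ge0 x : 0 <= normc x.
Proof. by case: x => a b; exact: sqrtr_ge0. Qed.

Lemma normc_sum I (s : seq I) (F : I -> R[i]) :
  normc (\sum_(i <- s) F i) <= \sum_(i <- s) normc (F i).
Proof.
elim/big_ind2 : _ => [|x a y b xa yb|//]; first by rewrite normc0.
by rewrite (le_trans (normc_triangle _ _))// lerD.
Qed.

(** A positive element of [R[i]] has zero imaginary part, so real tolerances are enough. *)
Lemma normc_cvgP T (F : set_system T) (FF : Filter F) (f : T -> R[i]^o) (l :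
  R[i]^o) :
  f @ F --> l <-> forall e : R, 0 < e -> \forall t \near F, normc (l - f t) < e.
Proof.
rewrite cvgrPdist_lt; split=> [fl e e0|fl [a b]].
  have := fl e%:C; rewrite ltcR => /(_ e0).
  by apply: filterS => t; rewrite normr_normc ltcR.
rewrite ltcE/= => /andP[/eqP -> /fl]; apply: filterS => t.
by rewrite normr_normc ltcR.
Qed.

Lemma continuous_normc (T : topologicalType) (f : T -> R[i]^o) :
  continuous f -> continuous (fun x : T => normc (f x) : R).
Proof.
move=> cf x; apply/cvgrPdist_lt => e e0.
have /normc_cvgP/(_ _ e0) := cf x; apply: filterS => y; apply: le_lt_trans.
rewrite ler_norml lerBlDr lerNl opprB lerBlDr; apply/andP; split.
  by rewrite normcB (le_trans _ (normc_triangle _ _))// subrK.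
by rewrite (le_trans _ (normc_triangle _ _))// subrK.
Qed.

Lemma cvg_real_complex T (F : set_system T) (FF : Filter F) (f : T -> R) (l :
  R) :
  f @ F --> l -> (fun t => (f t)%:C : R[i]^o) @ F --> (l%:C : R[i]^o).
Proof.
move=> /cvgrPdist_lt fl; apply/normc_cvgP => e /fl; apply: filterS => t.
by rewrite -rmorphB normc_real.
Qed.

End ComplexModulus.

(** * Lower bounds for the norms of an indicator *)

Section LowerBound.
Context {R : realType} {K : topologicalType}.
Implicit Types (A : set K) (f g : K -> R[i]^o) (phi : nat -> K -> R[i]^o).

Lemma sup_abs_sum_ge phi x N :
  ((\sum_(0 <= j < N) normc (phi j x))%:E <= sup_abs_sum phi)%E.
Proof.
apply: (@le_trans _ _ (\sum_(0 <= j <oo) (normc (phi j x))%:E)%E); last first.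
  by apply: ereal_sup_ubound; exists x.
rewrite -sumEFin; apply: nneseries_lim_ge => j _ _.
by rewrite lee_fin normc_ge0.
Qed.

(* Crossing from [boundary_iter A m.+1] to a nearby point of [boundary_iter A m]
   on the other side of [A] makes the series move by one more unit. *)
Lemma abs_sum_le_boundary_iter A g phi c : continuous g ->
  D_series (\1_A \- g) phi -> (sup_abs_sum phi <= c%:E)%E ->
  forall m x N, boundary_iter A m x ->
    \sum_(0 <= j < N) normc (phi j x) <= c - m%:R.
Proof.
move=> cg [cphi _ phif] phic; set f := _ \- g in phif.
pose S M y : R[i] := \sum_(0 <= j < M) phi j y.
pose V M y : R := \sum_(0 <= j < M) normc (phi j y).
have Scvg y e : 0 < e -> \forall M \near \oo, normc (f y - S M y) < e.
  by have /normc_cvgP := phif y; exact.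
have Scont M x e : 0 < e -> \forall y \near x, normc (S M x - S M y) < e.
  elim: M e => [|M IHM] e e0.
    by apply: nearW => y; rewrite /S !big_geq// subrr normc0.
  have e20 : 0 < e / 2 by rewrite divr_gt0.
  have /normc_cvgP/(_ _ e20) := cphi M x.
  apply: filterS2 (IHM _ e20) => y h1 h2.
  rewrite /S !big_nat_recr//= opprD addrACA (le_lt_trans (normc_triangle _
    _))//.
  by rewrite (splitr e) ltrD.
have Vcont M x e : 0 < e -> \forall y \near x, V M x - e < V M y.
  elim: M e => [|M IHM] e e0.
    by apply: nearW => y; rewrite /V !big_geq// sub0r oppr_lt0.
  have e20 : 0 < e / 2 by rewrite divr_gt0.
  have /cvgrPdist_lt/(_ _ e20) := @continuous_normc R K _ (cphi M) x.
  apply: filterS2 (IHM _ e20) => y h1 /ltr_normlW h2.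
  by rewrite /V !big_nat_recr//= -/(V M x) -/(V M y); lra.
(* Between [M] and [M'] the growth of the variation [V] dominates the displacement of the partial
   sums [S]. *)
have Vmono x M M' : (M <= M')%N -> V M x + normc (S M' x - S M x) <= V M' x.
  move=> MM'; rewrite /V /S !(big_cat_nat (leq0n M) MM')//= lerD2l addrAC subrr
    add0r.
  exact: normc_sum.
have V0 x M : V M x <= c.
  rewrite -lee_fin; apply: le_trans phic; exact: sup_abs_sum_ge.
elim=> [|m IHm] x N; first by move=> _; rewrite subr0; exact: V0.
rewrite boundary_iterS rel_boundaryE => -[[_ clAx] clnAx].
(* Five errors of size [e / 5] arise: the remainders at [x] and at [y], the moves of [g] and of
   [S M] from [x] to [y], and the loss from [V M x] to [V M y]. *)
apply/ler_addgt0Pr => e e0; have e50 : 0 < e / 5 by rewrite divr_gt0.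
have [M [NM SM]] : exists M, (N <= M)%N /\ normc (f x - S M x) < e / 5.
  near \oo => M; exists M; split; near: M; [exact: nbhs_infty_ge|exact: Scvg].
have /normc_cvgP/(_ _ e50) gx := cg x.
have near_x : \forall y \near x, normc (g x - g y) < e / 5 /\
    (normc (S M x - S M y) < e / 5 /\ V M x - e / 5 < V M y).
  by apply: filterS3 gx (Scont M x _ e50) (Vcont M x _ e50) => y ? ? ?; by [].
have [y [Ly [gxy [Sxy Vxy]] Axy]] : exists y, [/\ boundary_iter A m y,
    [/\ normc (g x - g y) < e / 5, normc (S M x - S M y) < e / 5
      & V M x - e / 5 < V M y] & (y \in A) = ~~ (x \in A)].
  have [Ax|nAx] := pselect (A x).
    have [y [[Ly nAy] [? [? ?]]]] := clnAx _ near_x.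
    by exists y; split=> //; rewrite (mem_set Ax) memNset.
  have [y [[Ay Ly] [? [? ?]]]] := clAx _ near_x.
  by exists y; split=> //; rewrite (mem_set Ay) memNset.
have [M' [MM' SM']] : exists M', (M <= M')%N /\ normc (f y - S M' y) < e / 5.
  near \oo => M'; exists M'; split; near: M';
    [exact: nbhs_infty_ge|exact: Scvg].
(* Up to four errors, the unit jump of the indicator is made at [y] by the terms between [M] and
   [M'], on top of the variation up to [M], which is nearly that at [x]. *)
have jump : 1 <= normc (f y - S M' y) + normc (S M' y - S M y) +
    normc (S M x - S M y) + normc (f x - S M x) + normc (g x - g y).
  have <- : normc ((y \in A)%:R - (x \in A)%:R : R[i]) = 1.
    suff n10 : normc (1 - 0 : R[i]) = 1 by rewrite Axy; case: (x \in A);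
      rewrite // normcB.
    by rewrite subr0; exact: normc1.
  rewrite (normcB (S M x)) (normcB (f x)) (normcB (g x)).
  have -> : (y \in A)%:R - (x \in A)%:R = (f y - S M' y) + (S M' y - S M y) +
      (S M y - S M x) + (S M x - f x) + (g y - g x) :> R[i].
    by rewrite /f /= !indicE; ring.
  by do 4 rewrite (le_trans (normc_triangle _ _))// lerD2r.
have := IHm y M' Ly; rewrite -/(V M' y) -/(V N x) => Vy.
have := Vmono y _ _ MM'.
have := Vmono x _ _ NM; have := normc_ge0 (S M x - S N x).
rewrite -[in m.+1%:R]addn1 natrD; lra.
Unshelve. all: by end_near.
Qed.

End LowerBound.

Section LowerBoundCorollaries.
Context {R : realType} {K : topologicalType}.
Implicit Types (A : set K) (f g : K -> R[i]^o) (phi : nat -> K -> R[i]^o).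

(** At a point of the boundary of order [n] the empty partial sum already gives [0 <= c - n%:R]. *)
Lemma D_norm_indicB_ge A g n : continuous g -> boundary_iter A n !=set0 ->
  (n%:R%:E <= D_norm (\1_A \- g)%R)%E.
Proof.
move=> cg [x Lx]; apply: le_ereal_inf_tmp => _ [phi phiA <-].
(* The empty partial sum makes the supremum nonnegative, which excludes the value -oo. *)
have := sup_abs_sum_ge phi x 0; rewrite big_geq//.
case E : (sup_abs_sum phi) => [c||] //; last by move=> _; rewrite leey.
move=> _; rewrite lee_fin -subr_ge0.
have phic : (sup_abs_sum phi <= c%:E)%E by rewrite E.
by have := abs_sum_le_boundary_iter cg phiA phic 0 Lx; rewrite big_geq.
Qed.

(** At a point of [A] the partial sums tend to 1, so the sums of moduli exceed [1 - e]; on the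
    boundary of order [n] they are at most [c - n%:R]. *)
Lemma D_norm_indic_ge A n : A `&` boundary_iter A n !=set0 ->
  (n.+1%:R%:E <= D_norm (\1_A : K -> R[i]^o))%E.
Proof.
move=> [x [Ax Lx]]; apply: le_ereal_inf_tmp => _ [phi phiA <-].
have := sup_abs_sum_ge phi x 0; rewrite big_geq//.
case E : (sup_abs_sum phi) => [c||] //; last by move=> _; rewrite leey.
move=> _; rewrite lee_fin; apply/ler_addgt0Pr => e e0.
have [_ _ /(_ x)/normc_cvgP/(_ _ e0)[N _ /(_ _ (leqnn N))/=]] := phiA.
rewrite indicE (mem_set Ax) => SN.
have S0 : D_series (\1_A \- (cst 0 : K -> R[i]^o)) phi.
  by rewrite (_ : _ \- _ = \1_A)//; apply/funext => y /=; rewrite subr0.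
have phic : (sup_abs_sum phi <= c%:E)%E by rewrite E.
have := abs_sum_le_boundary_iter (@cst_continuous _ _ _) S0 phic N Lx.
have := normc_sum (index_iota 0 N) (phi ^~ x).
have := normc_triangle (1 - series (phi ^~ x) N) (series (phi ^~ x) N).
rewrite subrK (_ : normc 1 = 1); last exact: normc1.
rewrite /series/= in SN *; rewrite -[in n.+1%:R]addn1 natrD; lra.
Qed.

End LowerBoundCorollaries.

(** * Lower semicontinuity and approximation from below *)

Section LowerSemicontinuous.
Context {R : realType}.

(** Meant for sums in which [p] carries the jumps, every point being a local minimum of it, and [q]
    the continuous part. *)
Lemma lsc_nearD (K : topologicalType) (p q : K -> R) :
  (forall x, \forall y \near x, p x <= p y) -> continuous q ->
  lower_semicontinuous (EFin \o (p \+ q)).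
Proof.
move=> px cq x a; rewrite /= lte_fin => apq.
have e0 : 0 < p x + q x - a by rewrite subr_gt0.
exists [set y | p x <= p y /\ `|q x - q y| < p x + q x - a].
  have /cvgrPdist_lt/(_ _ e0) := cq x; apply: filterS2 (px x) => y *; by split.
by move=> y [pxy /ltr_normlW qxy]; rewrite /= lte_fin; lra.
Qed.

(* The approximants are the inf-convolutions of [u] with [j d]. *)
Lemma lsc_nondecreasing_approx (K : metricType R) (u : K -> R) :
  (forall x, 0 <= u x) -> lower_semicontinuous (EFin \o u) ->
  exists s : nat -> K -> R, [/\ forall x, s 0%N x = 0,
    forall j, continuous (s j), forall j x, s j x <= s j.+1 x,
    forall j x, s j x <= u x & forall x, s ^~ x @ \oo --> u x].
Proof.
move=> u0 lscu.
pose h (j : nat) x := inf [set u y + j%:R * mdist x y | y in [set: K]].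
have term_ge0 (j : nat) x y : 0 <= u y + j%:R * mdist x y.
  by rewrite addr_ge0// mulr_ge0// mdist_ge0.
have h_le (j : nat) x y : h j x <= u y + j%:R * mdist x y.
  apply: ge_inf; last by exists y.
  by exists 0 => _ [z _ <-].
have h_ge (j : nat) x c : (forall y, c <= u y + j%:R * mdist x y) -> c <= h j x.
  move=> H; apply: lb_le_inf; first by exists (u x + j%:R * mdist x x), x.
  by move=> _ [z _ <-].
have h_lip (j : nat) x y : h j x - h j y <= j%:R * mdist x y.
  rewrite lerBlDr -lerBlDl; apply: h_ge => z.
  rewrite lerBlDl (le_trans (h_le j x z))// addrCA lerD2l -mulrDr.
  by rewrite ler_wpM2l// metric_triangle.
(* The zero function put in front makes the increments of the sequence telescope to its terms. *)
exists (fun j => if j is j'.+1 then h j' else cst 0); split=> //.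
- case=> [|j] x; first exact: cvg_cst.
  apply/cvgrPdist_lt => e e0.
  (* The Lipschitz constant is [j]; dividing by [j.+1] covers the case [j = 0]. *)
  have d0 : 0 < e / j.+1%:R by rewrite divr_gt0.
  have : nbhs x (ball x (e / j.+1%:R)) by exact: nbhsx_ballx.
  rewrite ballEmdist; apply: filterS => y /=; rewrite ltr_pdivlMr// => xye.
  have xy0 := mdist_ge0 x y.
  have : j%:R * mdist x y <= mdist x y * j.+1%:R.
    by rewrite mulrC ler_wpM2l// ler_nat.
  have := h_lip j x y; have := h_lip j y x;
    rewrite (metric_sym y x) => h1 h2 h3.
  by rewrite ltr_norml; apply/andP; split; lra.
- case=> [|j] x; apply: h_ge => y; first by rewrite term_ge0.
  by rewrite (le_trans (h_le j x y))// lerD2l ler_wpM2r ?mdist_ge0// ler_nat.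
- case=> [|j] x //; by rewrite (le_trans (h_le j x x))// mdistxx mulr0 addr0.
- move=> x; rewrite -cvg_shiftS/=; apply/cvgrPdist_lt => e e0.
  have : ((u x - e / 2)%:E < (EFin \o u) x)%E by rewrite lte_fin ltrBlDr ltrDl
    divr_gt0.
  move=> /lscu[V]; rewrite -nbhs_ballE => -[d /= d0 dV] Vu.
  (* Points within [d] of [x] are handled by semicontinuity; farther away the penalty is at least
     [j%:R * d], hence at least [u x]. *)
  near=> j.
  have jd : u x <= j%:R * d.
    rewrite -ler_pdivrMr//; near: j; exact: nbhs_infty_ger.
  have hu : h j x <= u x by rewrite (le_trans (h_le j x x))// mdistxx mulr0
    addr0.
  rewrite ger0_norm ?subr_ge0// ltrBlDr -ltrBlDl.
  apply: (@lt_le_trans _ _ (u x - e / 2)); first by lra.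
  apply: h_ge => y; have [xyd|dxy] := ltP (mdist x y) d.
    have : V y by apply: dV; rewrite ballEmdist.
    move=> /Vu; rewrite lte_fin => /ltW uy; rewrite (le_trans uy)// lerDl.
    by rewrite mulr_ge0// mdist_ge0.
  have : j%:R * d <= j%:R * mdist x y by rewrite ler_wpM2l.
  by have := u0 y; lra.
Unshelve. all: by end_near. Qed.

End LowerSemicontinuous.

(** * Upper bounds from differences of lower semicontinuous functions *)

Section UpperBound.
Context {R : realType} {K : metricType R}.
Local Open Scope complex_scope.

(** The series is made of the increments of approximants of [u] minus those of [v]. Both are
    nonnegative, so the sums of moduli are at most the sum of the two approximants, which stays
    below [u + v]. *)
Lemma D_norm_le (u v : K -> R) (c : R) :
  (forall x, 0 <= u x) -> (forall x, 0 <= v x) ->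
  lower_semicontinuous (EFin \o u) -> lower_semicontinuous (EFin \o v) ->
  (forall x, u x + v x <= c) ->
  (D_norm (fun x => (u x - v x)%:C : R[i]^o) <= c%:E)%E.
Proof.
move=> u0 v0 /(lsc_nondecreasing_approx u0)[s [s0 sc sS su sl]].
move=> /(lsc_nondecreasing_approx v0)[t [t0 tc tS tv tl]] uvc.
pose phi j x : R[i]^o := ((s j.+1 x - s j x) - (t j.+1 x - t j x))%:C.
have phic : (sup_abs_sum phi <= c%:E)%E.
  apply: ge_ereal_sup => _ [x _ <-]; apply: lime_le.
    by apply: is_cvg_nneseries => j _ _; rewrite lee_fin normc_ge0.
  apply: nearW => N; rewrite sumEFin lee_fin.
  apply: (@le_trans _ _ (s N x + t N x));
    last by rewrite (le_trans _ (uvc x))// lerD.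
  have -> : s N x + t N x = \sum_(0 <= j < N) ((s j.+1 x + t j.+1 x) - (s j x +
    t j x)).
    by rewrite telescope_sumr// s0 t0 addr0 subr0.
  apply: ler_sum => j _; rewrite normc_real.
  have := sS j x; have := tS j x; rewrite ler_norml => ? ?.
  by apply/andP; split; lra.
apply: ge_ereal_inf; exists (sup_abs_sum phi) => //.
exists phi => //; split.
- move=> j x; apply: cvg_real_complex.
  by apply: cvgB; apply: cvgB; (exact: sc || exact: tc).
- exact: le_lt_trans phic (ltry _).
- move=> x.
  have -> : series (phi ^~ x) = fun N => (s N x - t N x)%:C :> R[i]^o.
    apply/funext => N; rewrite /series/= -rmorph_sum/=; congr _%:C.
    rewrite -[RHS](subr0) -[X in _ - X](_ : s 0%N x - t 0%N x = 0);
      last by rewrite s0 t0 subrr.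
    rewrite -(telescope_sumr (fun N => s N x - t N x))//.
    by apply: eq_bigr => j _; lra.
  apply: cvg_real_complex; exact: cvgB.
Qed.

(* Where [\1_A] jumps, [r] drops by at least one, so neither
   [- r + \1_A] nor [- r - \1_A] can fall below its value at the point. *)
Lemma indicB_lsc_decomposition (A : set K) r (g : K -> R) (N : R) :
  stratified A r -> continuous g ->
  (forall x, `|(x \in A)%:R - g x| <= N - (r x)%:R) ->
  exists u v : K -> R, [/\ forall x, 0 <= u x /\ 0 <= v x,
    lower_semicontinuous (EFin \o u), lower_semicontinuous (EFin \o v),
    forall x, u x + v x <= N & forall x, (x \in A)%:R - g x = u x - v x].
Proof.
move=> sAr cg gN.
have drop x y : (r y <= r x)%N -> (r y = r x -> (A y <-> A x)) ->
    (r y)%:R + 1 <= (r x)%:R :> R \/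
    (r y)%:R = (r x)%:R :> R /\ (y \in A) = (x \in A).
  move=> ryx AE; have [rE|ne] := eqVneq (r y) (r x); last first.
    by left; rewrite natr1 ler_nat ltn_neqAle ne.
  right; rewrite rE; split=> //; have [yx xy] := AE rE.
  by apply/idP/idP; rewrite !inE.
(* In each function the first summand has a local minimum at every point, by [drop], and the second
   is continuous. *)
exists ((fun x => ((x \in A)%:R - (r x)%:R) / 2) \+ (fun x => (N - g x) / 2)).
exists ((fun x => (- (x \in A)%:R - (r x)%:R) / 2) \+ (fun x => (N + g x) / 2)).
split=> [x||||].
- by have := gN x; rewrite ler_norml => /andP[? ?] /=; split; lra.
- apply: lsc_nearD => x.
    apply: filterS (sAr x) => y [ryx AE]; rewrite ler_pM2r//.
    by have [|[-> ->]//] := drop x y ryx AE; case: (x \in A);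
      case: (y \in A) => /=; lra.
  apply: cvgM; last exact: cvg_cst.
  by apply: cvgB; [exact: cvg_cst|exact: cg].
- apply: lsc_nearD => x.
    apply: filterS (sAr x) => y [ryx AE]; rewrite ler_pM2r//.
    by have [|[-> ->]//] := drop x y ryx AE; case: (x \in A);
      case: (y \in A) => /=; lra.
  apply: cvgM; last exact: cvg_cst.
  by apply: cvgD; [exact: cvg_cst|exact: cg].
- by move=> x /=; have := ler0n R (r x); lra.
- by move=> x /=; lra.
Qed.


End UpperBound.

(** * Upper bounds for the norms of an indicator *)

Section IndicatorNorms.
Context {R : realType} {K : metricType R}.
Implicit Types A : set K.
Local Open Scope complex_scope.

Lemma D_norm_indicB_le A r (g : K -> R) (N : R) :
  stratified A r -> continuous g ->
  (forall x, `|(x \in A)%:R - g x| <= N - (r x)%:R) ->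
  (D_norm (\1_A \- (fun x => (g x)%:C : R[i]^o))%R <= N%:E)%E.
Proof.
move=> sAr cg gN.
have [u [v [uv0 lu lv uvN uvE]]] := indicB_lsc_decomposition sAr cg gN.
have -> : \1_A \- (fun x => (g x)%:C) = (fun x => (u x - v x)%:C : R[i]^o).
  by apply/funext => x /=; rewrite indicE -uvE rmorphB/= rmorph_nat.
by apply: D_norm_le => // x; have [] := uv0 x.
Qed.

Lemma D_norm_indic_le A r (N : R) : stratified A r ->
  (forall x, (x \in A)%:R + (r x)%:R <= N) ->
  (D_norm (\1_A : K -> R[i]^o) <= N%:E)%E.
Proof.
move=> sAr AN.
have -> : (\1_A : K -> R[i]^o) = \1_A \- (fun x => (cst 0 x : R)%:C : R[i]^o).
  by apply/funext => x /=; rewrite subr0.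
apply: D_norm_indicB_le sAr _ _; first exact: cst_continuous.
by move=> x /=; rewrite subr0 ger0_norm// lerBrDr.
Qed.

Lemma D_space_indic A r (N : R) : stratified A r ->
  (forall x, (r x)%:R <= N) -> D_space (\1_A : K -> R[i]^o).
Proof.
move=> sAr rN; have bounded (w : K -> R) : (forall x, 0 <= w x <= N + 1) ->
  bounded_fun w.
  move=> wN; exists (N + 1); split; first exact: num_real.
  move=> z Nz x _ /=; have /andP[w0 wx] := wN x.
  by rewrite ger0_norm// (le_trans wx)// ltW.
(* The extra 1 in [N + 1] leaves room for the indicator above [r]. *)
have [||u [v [uv0 lu lv uvN uvE]]] :=
    @indicB_lsc_decomposition R K A r (cst 0) (N + 1) sAr.
- exact: cst_continuous.
- move=> x /=; rewrite subr0 ger0_norm//.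
  by have := rN x; case: (x \in A) => /=; lra.
have lsc0 : bounded_lsc (cst 0 : K -> R).
  split; last by move=> x a a0; exists setT; [exact: filterT|].
  by apply: bounded => x /=; rewrite lexx/=; have := rN x;
    have := ler0n R (r x); lra.
exists u, v, (cst 0), (cst 0); split=> //.
- by split=> //; apply: bounded => x; have [? ?] := uv0 x; have := uvN x; lra.
- by split=> //; apply: bounded => x; have [? ?] := uv0 x; have := uvN x; lra.
move=> x; rewrite indicE -uvE /= !subr0.
by case: (x \in A).
Qed.

(** The boundary of order [n.+1] is empty, so [A] is relatively clopen in that of order [n], and
    some continuous [g] with values in [0,1] equals the indicator there. Elsewhere [r] is less than
    [n], which leaves room for an error of 1. *)
Lemma qD_norm_indic_le A r n : boundary_rank A r -> (forall x, (r x <= n)%N) ->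
  (qD_norm (\1_A : K -> R[i]^o) <= n%:R%:E)%E.
Proof.
move=> rP rn; pose L := boundary_iter A n.
have cL : closed L := @closed_boundary_iter _ A n.
have Lr x : L x -> r x = n by move=> /rP nr; apply/eqP; rewrite eqn_leq rn.
have clopenL x : closure (A `&` L) x -> closure (L `\` A) x -> False.
  move=> clA clnA; suff /rP : boundary_iter A n.+1 x by rewrite ltnNge rn.
  rewrite boundary_iterS rel_boundaryE; split=> //; split=> //.
  by apply: cL; apply: closure_subset clA; exact: subIsetr.
have cLA : closed (A `&` L).
  move=> x clx; have Lx : L x by apply: cL; apply: closure_subset clx;
    exact: subIsetr.
  split=> //; apply: contrapT => nAx; apply: (clopenL x) => //;
    exact: subset_closure.
have cLnA : closed (L `\` A).
  move=> x clx; have Lx : L x by apply: cL; apply: closure_subset clx;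
    exact: subDsetl.
  split=> // Ax; apply: (clopenL x) => //; exact: subset_closure.
have [|g [cg g0 g1 g01]] := @urysohn_ext_itv K R pseudometric_normal _ _ 0 1
  cLnA cLA _ ltr01.
  by apply/seteqP; split=> x // [[_ nAx] [Ax _]].
have g01' x : 0 <= g x <= 1 by have := g01 (g x); rewrite /= in_itv/=; apply;
  exists x.
apply: ge_ereal_inf; exists (D_norm (\1_A \- (fun x => (g x)%:C : R[i]^o))%R).
  exists (fun x => (g x)%:C) => //; split.
    by move=> x; apply: cvg_real_complex; exact: cg.
  exists 1; split; first exact: real1.
  move=> z z1 x _ /=; rewrite normr_normc normc_real.
  rewrite (le_trans _ (ltW z1))// lecR ler_norml.
  by have /andP[] := g01' x; lra.
apply: D_norm_indicB_le (boundary_rank_stratified rP) cg _ => x.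
have [rx|rx] := eqVneq (r x) n.
  have Lx : L x by apply/rP; rewrite rx.
  rewrite rx subrr normr_le0 subr_eq0; have [Ax|nAx] := pselect (A x).
    by rewrite mem_set// (g1 (g x))//; exists x.
  by rewrite memNset// (g0 (g x))//; exists x.
have : (r x).+1%:R <= n%:R :> R by rewrite ler_nat ltn_neqAle rx rn.
rewrite -addn1 natrD ler_norml; have := g01' x.
by case: (x \in A) => /=; lra.
Qed.

End IndicatorNorms.

Theorem theorem2p2 (R : realType) (K : metricType R) (hK : [set: K] !=set0)
    (A : set K) :
  (closed_algebra A <-> finite_index A) /\
  forall n : nat, boundary_index A = Some n ->
    let chiA : K -> R[i]^o := \1_A in
    [/\ D_space chiA,
        qD_norm chiA = n%:R%:E,
        (A `&` boundary_iter A n = set0 -> D_norm chiA = n%:R%:E) /\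
        (A `&` boundary_iter A n !=set0 -> D_norm chiA = n.+1%:R%:E),
        A `&` boundary_iter A n = set0 ->
          exists B : 'I_((n + 1) %/ 2) -> set K,
            disjoint_DCS_union A B /\ (odd n -> exists i, open (B i)) &
        A `&` boundary_iter A n !=set0 ->
          exists B : 'I_((n + 2) %/ 2) -> set K,
            disjoint_DCS_union A B /\ (~~ odd n -> exists i, open (B i))].
Proof.
split; first exact: closed_algebraP.
move=> n /boundary_indexP[An0 nmax] chiA.
have An1 : boundary_iter A n.+1 = set0.
  by apply/eqP/negP => /negP/set0P/nmax; rewrite ltnn.
have [r rP] := boundary_rank_exists An1.
have sAr := boundary_rank_stratified rP.
have rn x : (r x <= n)%N.
  by rewrite leqNgt; apply/negP => /rP; rewrite An1.
have rnR x : (r x)%:R <= n%:R :> R by rewrite ler_nat.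
have Dge : (n%:R%:E <= D_norm chiA)%E.
  have := @D_norm_indicB_ge R K A (cst 0) n (@cst_continuous _ _ _) An0.
  by rewrite (_ : _ \- _ = chiA)//; apply/funext => x /=; rewrite subr0.
split.
- exact: D_space_indic sAr rnR.
- apply/eqP; rewrite eq_le (qD_norm_indic_le rP rn)/=.
  by apply: le_ereal_inf_tmp => _ [g [cg _] <-]; exact: D_norm_indicB_ge.
- split=> [AL0|AL].
    (* On [A] the rank is less than [n], which makes room for the value 1 of the indicator. *)
    apply/eqP; rewrite eq_le Dge andbT; apply: D_norm_indic_le sAr _ => x.
    have [Ax|nAx] := pselect (A x); last by rewrite memNset// add0r.
    rewrite mem_set//= nat1r ler_nat ltn_neqAle rn andbT; apply/eqP => rx.
    have Lx : boundary_iter A n x by apply/rP; rewrite rx.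
    by have : set0 x by rewrite -AL0.
  apply/eqP; rewrite eq_le D_norm_indic_ge// andbT.
  apply: D_norm_indic_le sAr _ => x; rewrite -nat1r lerD//.
  by case: (x \in A).
- exact: disjoint_DCS_union_exists.
(* The decomposition is used one order higher, where the boundary is empty; this switches the parity
   condition and gives [(n + 2) %/ 2] pieces. *)
- move=> _; have /(disjoint_DCS_union_exists rP)/= : A `&` boundary_iter A n.+1
  = set0.
    by rewrite An1 setI0.
  by rewrite addSnnS.
Qed.
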